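(* Assume the $\bar p_\alpha$-measure condition with exponent $\kappa$: there are $\bar\alpha>0$ and a constant $C$ such that $$\operatorname{meas}(I_\alpha)\le C\alpha^\kappa\quad\text{for all }0<\alpha<\bar\alpha,\qquad I_\alpha:=\{x\in\Omega_U:\alpha a(x)<-B^*\bar p_\alpha(x)<\alpha b(x)\}.$$ Assume moreover the $\sigma$-condition: there is $\sigma>0$ such that $a(x)\le-\sigma<0<\sigma\le b(x)$ for almost all $x\in\Omega_U$. Then for any solution $\bar u_0$ of $(\mathbb P_0)$, with $\bar y_0=T\bar u_0$, there is a constant $C>0$ independent of $\alpha$ such that for all $0<\alpha<\bar\alpha$ $$\|\bar u_\alpha-\bar u_0\|_{L^1(\Omega_U)}\le C\alpha^\kappa\quad\text{and}\quad\|\bar y_\alpha-\bar y_0\|_H\le C\alpha^{(\kappa+1)/2}.$$ If in addition $\kappa>1$ and $T^*:\operatorname{range}(T)\to L^\infty(\Omega_U)$ exists and is continuous (i.e. $T^*v\in L^\infty(\Omega_U)$ and $\|T^*v\|_{L^\infty(\Omega_U)}\le c\,\|v\|_H$ for all $v\in\operatorname{range}(T)\subset H$, with some constant $c>0$), then one has the improved estimate $$\|\bar y_\alpha-\bar y_0\|_H\le C\alpha^\kappa .$$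
   Context: Setting. $\Omega_U\subset\mathbb R^n$, $n\ge1$, is a bounded measurable domain, $U:=L^2(\Omega_U)$ (real-valued), $H$ is an arbitrary (real) Hilbert space, $z\in H$ is fixed, and $T:U\to H$ is linear and continuous, written as $T=SB$ with continuous linear operators $B:U\to R$, $S:R\to H$ for some function space $R$ (always possible, e.g. $B=\mathrm{Id}$, $S=T$). Adjoints are denoted by $^*$, and $U$, $H$ are identified with their duals. Bounds $a,b\in L^\infty(\Omega_U)$ with $a\le b$ are given and $U_{\rm ad}:=\{u\in U: a(x)\le u(x)\le b(x)\text{ for almost all }x\in\Omega_U\}$. For $\alpha\ge0$, problem $(\mathbb P_\alpha)$ is $\min_{u\in U_{\rm ad}}\ \frac12\|Tu-z\|_H^2+\frac\alpha2\|u\|_U^2$. It has at least one solution $\bar u_\alpha$, which is unique if $\alpha>0$. Put $\bar y_\alpha:=T\bar u_\alpha$ and $\bar p_\alpha:=S^*(\bar y_\alpha-z)$, so that $B^*\bar p_\alpha=T^*(T\bar u_\alpha-z)\in U$; $\bar y_\alpha$ and $\bar p_\alpha$ are unique for every $\alpha\ge0$, even if $\bar u_0$ is not. In the $\bar p_\alpha$-measure condition, $\kappa>0$, with the convention that $\kappa:=\infty$ if $\operatorname{meas}(I_\alpha)=0$ for all $0<\alpha<\bar\alpha$; in that case an estimate whose exponent of $\alpha$ is infinite is read as holding for every finite exponent (with constant depending on that exponent). *)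

(* Defs.v *)
From HB Require Import structures.
From mathcomp Require Import all_boot all_order all_algebra.
From mathcomp Require Import all_classical all_reals all_analysis.

Set Implicit Arguments.
Unset Strict Implicit.
Unset Printing Implicit Defensive.

Import Order.TTheory GRing.Theory Num.Theory.
Import numFieldNormedType.Exports.

Local Open Scope classical_set_scope.
Local Open Scope ring_scope.

(** * Lebesgue measure on R^n, n >= 1 (the dimension is written n.+1)

    The library only has Lebesgue measure on the line.  In higher dimension we
    take the outer measure given by countable covers with boxes, and feed it to
    the library's Caratheodory construction: the measurable sets are exactly
    the Lebesgue measurable ones. *)

Section lebesgue_outer_measure.
Context (R : realType) (n : nat).
Local Notation V := 'rV[R]_n.+1.

Definition box (I : V * V) : set V :=
  [set x | forall i, I.1 0 i <= x 0 i <= I.2 0 i].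

Definition box_volume (I : V * V) : R := \prod_(i < n.+1) (I.2 0 i - I.1 0 i).

Definition box_cover (X : set V) : set (nat -> V * V) :=
  [set I : nat -> V * V |
    (forall k i, (I k).1 0 i <= (I k).2 0 i) /\ X `<=` \bigcup_k box (I k)].

Definition lebesgue_outer (X : set V) : \bar R :=
  ereal_inf [set (\sum_(k <oo) (box_volume (I k))%:E)%E | I in box_cover X].

Local Open Scope ereal_scope.

Let vol_ge0 X (I : nat -> V * V) k : box_cover X I -> 0 <= (box_volume (I k))%:E.
Proof.
by move=> [Ile _]; rewrite lee_fin prodr_ge0// => i _; rewrite subr_ge0.
Qed.

Let lebesgue_outer_ge0 X : 0 <= lebesgue_outer X.
Proof.
apply: le_ereal_inf_tmp => _ [I IX <-]; apply: nneseries_ge0 => k _ _.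
exact: vol_ge0 IX.
Qed.

Let lebesgue_outer0 : lebesgue_outer set0 = 0.
Proof.
apply/eqP; rewrite eq_le lebesgue_outer_ge0 andbT.
apply: ereal_inf_lbound; exists (fun=> (0%R, 0%R)).
  by split=> [k i|]; [rewrite lexx | exact: sub0set].
apply: eseries0 => k _ _.
by rewrite /box_volume big_ord_recl subrr mul0r.
Qed.

Let le_lebesgue_outer : {homo lebesgue_outer : A B / A `<=` B >-> A <= B}.
Proof.
move=> A B AB; apply/ereal_inf_le_tmp => x [I [Ile BI] <-].
by exists I => //; split => //; exact: subset_trans AB BI.
Qed.

Let lebesgue_outer_sigma_subadditive : sigma_subadditive lebesgue_outer.
Proof.
move=> A; have [[i ioo]|] := pselect (exists i, lebesgue_outer (A i) = +oo).
  by rewrite (eseries_pinfty _ _ ioo) ?leey// => k _; rewrite -ltNye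
    (lt_le_trans _ (lebesgue_outer_ge0 _)).
rewrite -forallNE => Aoo.
suff add2e (e : {posnum R}) : lebesgue_outer (\bigcup_k A k) <=
    \sum_(i <oo) lebesgue_outer (A i) + e%:num%:E.
  by apply/lee_addgt0Pr => _/posnumP[].
rewrite (le_trans _ (epsilon_trick _ _ _))//.
pose P i (I : nat -> V * V) := box_cover (A i) I /\
  \sum_(k <oo) (box_volume (I k))%:E <=
    lebesgue_outer (A i) + (e%:num / (2 ^ i.+1)%:R)%:E.
have [G PG] : {G : nat -> nat -> V * V & forall i, P i (G i)}.
  apply: (@choice _ _ P) => i; rewrite /P.
  have Afin : lebesgue_outer (A i) \is a fin_num.
    by rewrite ge0_fin_numE// ltey; apply/eqP; exact: Aoo.
  have e0 : (0 < e%:num / (2 ^ i.+1)%:R)%R by [].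
  have [_ [I AI <-] Ie] := lb_ereal_inf_adherent e0 Afin.
  by exists I; split => //; exact/ltW.
pose vol (ij : nat * nat) := (box_volume (G ij.1 ij.2))%:E.
have vol0 ij : 0 <= vol ij by exact: vol_ge0 (PG ij.1).1.
apply: (@le_trans _ _ (\esum_(i in setT) vol i)).
  have /card_esym/ppcard_eqP[f] := card_nat2.
  apply: ereal_inf_lbound => /=; exists (fun k => G (f k).1 (f k).2).
    split=> [k i|x [i _ Aix]]; first exact: (PG (f k).1).1.1.
    have [j _ xj] := (PG i).1.2 _ Aix.
    by exists (f^-1%FUN (i, j)) => //=; rewrite invK ?inE.
  rewrite -[RHS](_ : \esum_(i in f @` setT) vol i = _); last by rewrite image_eq.
  by rewrite -(esum_pred_image vol _ xpredT) ?[fun=> _]set_true.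
rewrite (_ : esum _ _ = \sum_(i <oo) \sum_(j <oo) vol (i, j)); last first.
  pose J : nat -> set (nat * nat) := fun i => [set (i, j) | j in setT].
  rewrite (_ : setT = \bigcup_k J k); last first.
    by rewrite predeqE => -[a b]; split => // _; exists a => //; exists b.
  rewrite esum_bigcupT /=; last 2 first.
    - apply/trivIsetP => i j _ _ ij.
      rewrite predeqE => -[p m] /=; split => //= -[] [_] _ [<-{p} _].
      by move=> [m' _] [] /esym/eqP; rewrite (negbTE ij).
    - by [].
  rewrite -(image_id [set: nat]) -fun_true esum_pred_image//; last first.
    by move=> i _; exact: esum_ge0.
  apply: eq_eseriesr => /= i _.
  rewrite -(esum_pred_image vol (pair i) predT)//=; last first.
    by move=> ? ? _ _; exact: (@can_inj _ _ _ snd).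
  by congr esum; rewrite predeqE => -[a b]; split; move=> [j _ <-]; exists j.
apply: lee_lim.
- by apply: is_cvg_nneseries => i *; apply: nneseries_ge0 => j *; exact: vol0.
- by apply: is_cvg_nneseries => i *; exact: adde_ge0.
- by near=> i; apply: lee_sum => j _; exact: (PG j).2.
Unshelve. all: by end_near. Qed.

HB.instance Definition _ := isOuterMeasure.Build R V lebesgue_outer
  lebesgue_outer0 lebesgue_outer_ge0 le_lebesgue_outer
  lebesgue_outer_sigma_subadditive.

Definition lebesgue_om : {outer_measure set V -> \bar R} := lebesgue_outer.

End lebesgue_outer_measure.

(** R^(n+1) with its Lebesgue sigma-algebra. *)
Notation lebesgue_space R n := (caratheodory_type (@lebesgue_om R n)).

Definition lebesgue (R : realType) (n : nat) :
  {measure set (lebesgue_space R n) -> \bar R} := @lebesgue_om R n.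

(** Lebesgue measure on a domain: A |-> meas (A `&` Omega). *)
Definition lebesgue_on (R : realType) (n : nat)
    (Omega : set (lebesgue_space R n)) (mOmega : measurable Omega) :
  {measure set (lebesgue_space R n) -> \bar R} := mrestr (@lebesgue R n) mOmega.

(** * The space U = L^2(mu)

    Elements of U are represented by square-integrable functions (the library's
    [LfunType]), two representatives being identified when they agree almost
    everywhere.  A linear map on [LfunType] that is continuous for the L^2
    seminorm factors through this identification.  For [mu = lebesgue_on mOmega]
    values outside the domain are irrelevant. *)

Notation L2 mu := (LfunType mu (lee1n 2)).

Section control_problem.
Context d (X : measurableType d) (R : realType).
Variable mu : {measure set X -> \bar R}.

Definition L2norm (u : L2 mu) : R := fine 'N[mu]_2%:E[EFin \o u]%E.

Definition L2inner (u v : L2 mu) : R := \int[mu]_x (u x * v x).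

Definition L2_continuous (W : normedModType R) (f : L2 mu -> W) : Prop :=
  forall u (e : R), 0 < e -> exists2 delta : R, 0 < delta &
    forall v, L2norm (v - u) < delta -> `|f v - f u| < e.

(** Adjoint B^* : W' -> U of a map B : U -> W, with U identified with its dual. *)
Definition is_L2_adjoint (W : normedModType R) (B : L2 mu -> W)
    (Bstar : (W -> R) -> L2 mu) : Prop :=
  forall p : {linear W -> R^o}, continuous p ->
  forall u, L2inner (Bstar p) u = p (B u).

Definition admissible (a b : X -> R) (u : L2 mu) : Prop :=
  \forall x \ae mu, a x <= u x <= b x.

Section problem.
Context (H : normedModType R) (T : L2 mu -> H) (z : H) (a b : X -> R).

Definition objective (alpha : R) (u : L2 mu) : R :=
  2^-1 * `|T u - z| ^+ 2 + alpha / 2 * L2norm u ^+ 2.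

Definition solves (alpha : R) (u : L2 mu) : Prop :=
  admissible a b u /\
  forall v, admissible a b v -> objective alpha u <= objective alpha v.

End problem.

(** The set I_alpha, with q standing for B^* p_alpha. *)
Definition inactive_set (a b : X -> R) (alpha : R) (q : X -> R) : set X :=
  [set x | alpha * a x < - q x < alpha * b x].

End control_problem.

(** Adjoint S^* : H -> W' of a map S : W -> H, with H identified with its dual
    through the inner product. *)
Definition hilbert_adjoint (R : realType) (W H : lmodType R)
  (dot : H -> H -> R) (S : W -> H) (h : H) : W -> R := fun w => dot h (S w).

(** [f alpha <= C * alpha^k] on ]0, abar[ for a possibly infinite exponent k:
    an estimate with exponent +oo means one for every finite exponent, with a
    constant depending on that exponent. *)
Definition power_estimate (R : realType) (abar : R) (k : \bar R)
    (f : R -> \bar R) : Prop :=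
  let estimate (r : R) := exists2 C : R, 0 < C &
    forall alpha, 0 < alpha < abar -> (f alpha <= (C * alpha `^ r)%:E)%E in
  match k with
  | EFin r => estimate r
  | +oo%E => forall r, estimate r
  | -oo%E => False
  end.

(** [m alpha] stands for meas(I_alpha); the exponent +oo is reserved for the
    case where these measures all vanish. *)
Definition measure_condition (R : realType) (abar : R) (kappa : \bar R)
    (m : R -> \bar R) : Prop :=
  match kappa with
  | EFin r => exists C : R,
      forall alpha, 0 < alpha < abar -> (m alpha <= (C * alpha `^ r)%:E)%E
  | +oo%E => forall alpha, 0 < alpha < abar -> m alpha = 0%E
  | -oo%E => False
  end.

(* Main.v *)
(** Testing the optimality conditions of [(P_alpha)] and [(P_0)] with each
    other's solution gives |y_alpha - y_0|^2 <= alpha (u_alpha, u_0 - u_alpha).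
    Moreover u_alpha is the projection of -B^*p_alpha / alpha onto [[a, b]], so
    off I_alpha it sits on one of the bounds, which are at distance at least
    sigma from 0 on either side; there
    u_alpha (u_0 - u_alpha) <= - sigma |u_alpha - u_0|.
    On I_alpha the integrand is merely bounded, whence
    |y_alpha - y_0|^2 + alpha sigma |u_alpha - u_0|_1 <= K alpha meas(I_alpha),
    which yields the first two estimates.  The third one follows from
    |y_alpha - y_0|^2 = (T^*(y_alpha - y_0), u_alpha - u_0)
    <= c |y_alpha - y_0| |u_alpha - u_0|_1. *)
Require Import Defs.
From HB Require Import structures.
From mathcomp Require Import all_boot all_order all_algebra.
From mathcomp Require Import all_classical all_reals all_analysis.
From mathcomp Require Import measurable_realfun ess_sup_inf ring lra.

Set Implicit Arguments.
Unset Strict Implicit.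
Unset Printing Implicit Defensive.

Import Order.TTheory GRing.Theory Num.Theory.
Import numFieldNormedType.Exports.

Local Open Scope classical_set_scope.
Local Open Scope ring_scope.

(** * Integral comparison and essential bounds *)

Section ae_integrals.
Context d (X : measurableType d) (R : realType).
Variable mu : {measure set X -> \bar R}.

(** The comparison holds only almost everywhere, so [g - f] is replaced by its absolute value, which
    agrees with it almost everywhere and is nonnegative everywhere. *)
Lemma ae_le_Rintegral (f g : X -> R) :
  mu.-integrable setT (EFin \o f) -> mu.-integrable setT (EFin \o g) ->
  (\forall x \ae mu, f x <= g x) -> \int[mu]_x f x <= \int[mu]_x g x.
Proof.
move=> fi gi fg; rewrite -subr_ge0 -RintegralB//.
have mfg : measurable_fun setT (fun x => g x - f x).
  apply/measurable_EFinP.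
  exact: measurable_int (integrableB measurableT gi fi).
have -> : \int[mu]_x (g x - f x) = \int[mu]_x `|g x - f x|.
  congr fine; apply: ae_eq_integral => //.
  - exact/measurable_EFinP.
  - by apply/measurable_EFinP; exact: measurableT_comp.
  - by apply: filterS fg => x fgx _; rewrite ger0_norm// subr_ge0.
exact: Rintegral_ge0.
Qed.

Lemma Rintegral_indic (A : set X) : measurable A ->
  \int[mu]_x \1_A x = fine (mu A).
Proof. by move=> mA; rewrite /Rintegral integral_indic// setIT. Qed.

Lemma Lfun_measurable (p : \bar R) (f : X -> R) :
  f \in Lfun mu p -> measurable_fun setT f.
Proof. by move=> /sub_Lfun_mfun; rewrite inE. Qed.

(** The $L^\infty$ norm is an essential supremum only if the whole space has positive measure; on a
    null space every bound holds almost everywhere. *)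
Lemma Lfun_oo_bounded (f : X -> R) : f \in Lfun mu +oo%E ->
  exists M : R, \forall x \ae mu, `|f x| <= M.
Proof.
rewrite inE => /andP[_]; rewrite inE/= /finite_norm unlock.
case: ifPn => [_ /ess_supr_bounded[M fM]|]; first by exists M.
rewrite -leNgt => mu0 _; exists 0.
exists setT; split => //.
by apply/eqP; rewrite eq_le mu0 measure_ge0.
Qed.

Lemma Lnorm_oo_le_ae (f : X -> R) (M : R) :
  ('N[mu]_+oo[EFin \o f] <= M%:E)%E -> \forall x \ae mu, `|f x| <= M.
Proof.
rewrite unlock; case: ifPn => [_ /ess_supP|].
  by apply: filterS => x; rewrite /= lee_fin.
rewrite -leNgt => mu0 _.
exists setT; split => //.
by apply/eqP; rewrite eq_le mu0 measure_ge0.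
Qed.

Lemma bounded_Lfun2 (f : X -> R) (M : R) : mu setT \is a fin_num ->
  measurable_fun setT f -> (\forall x \ae mu, `|f x| <= M) ->
  f \in Lfun mu 2%:E.
Proof.
move=> muT mf fM; suff : f \in Lfun mu +oo%E.
  by apply: (@Lfun_subset _ _ _ mu 2%:E +oo%E) => //;
    rewrite ?leey ?lee_fin ?ler1n.
rewrite inE; apply/andP; split; rewrite inE//= /finite_norm unlock.
case: ifPn => // _; apply: (@le_lt_trans _ _ M%:E); last exact: ltry.
by apply/ess_supP; apply: filterS fM => x; rewrite /= lee_fin.
Qed.

(** Serves to integrate the pointwise bound behind the error estimate, with [h] the indicator of
    $I_\alpha$. *)
Lemma ae_le_Rintegral_comb (f g h : X -> R) (s k : R) :
  mu.-integrable setT (EFin \o f) -> mu.-integrable setT (EFin \o g) ->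
  mu.-integrable setT (EFin \o h) ->
  (\forall x \ae mu, f x + s * g x <= k * h x) ->
  \int[mu]_x f x + s * \int[mu]_x g x <= k * \int[mu]_x h x.
Proof.
move=> fi gi hi fgh.
have si : mu.-integrable setT (EFin \o (fun x => s * g x)).
  exact: (integrableZl measurableT s gi).
have ki : mu.-integrable setT (EFin \o (fun x => k * h x)).
  exact: (integrableZl measurableT k hi).
rewrite -!RintegralZl// -RintegralD//; apply: ae_le_Rintegral => //.
exact: (integrableD measurableT fi si).
Qed.

Lemma fin_num_integrable_indic (A : set X) : mu setT \is a fin_num ->
  measurable A -> mu.-integrable setT (EFin \o \1_A).
Proof.
move=> muT mA; apply/Lfun1_integrable/Lfun_subset12 => //.
apply: (@bounded_Lfun2 _ 1) => //.
by apply: aeW => x; rewrite indicE normr_nat; case: (_ \in _).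
Qed.

Lemma measurable_inactive_set (a b : X -> R) (alpha : R) (q : X -> R) :
  measurable_fun setT a -> measurable_fun setT b -> measurable_fun setT q ->
  measurable (inactive_set a b alpha q).
Proof.
move=> ma mb mq; have mNq : measurable_fun setT (- q).
  exact: measurableT_comp.
have -> : inactive_set a b alpha q =
    (fun x => (alpha * a x < - q x) && (- q x < alpha * b x)) @^-1` [set true].
  by apply/seteqP; split.
rewrite -[X in measurable X]setTI.
by apply: measurable_and => //; apply: measurable_fun_ltr => //;
  apply: measurable_funM.
Qed.

End ae_integrals.

(** * Inner product calculus in $L^2$ *)

Section L2_inner_product.
Context d (X : measurableType d) (R : realType).
Variable mu : {measure set X -> \bar R}.
Implicit Types u v w : L2 mu.

Lemma L2_mul_integrable u v :
  mu.-integrable setT (EFin \o (fun x => u x * v x)).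
Proof. by apply/Lfun1_integrable/Lfun2_mul_Lfun1; exact: LfunP. Qed.

Lemma L2inner_ge0 u : 0 <= L2inner u u.
Proof. by apply: Rintegral_ge0 => x _; rewrite -expr2 sqr_ge0. Qed.

Lemma L2innerC u v : L2inner u v = L2inner v u.
Proof. by apply: eq_Rintegral => x _; rewrite mulrC. Qed.

Lemma L2innerDr w u v : L2inner w (u + v) = L2inner w u + L2inner w v.
Proof.
rewrite /L2inner -RintegralD//; [|exact: L2_mul_integrable..].
by apply: eq_Rintegral => x _; rewrite mulrDr.
Qed.

Lemma L2innerZr w (c : R) u : L2inner w (c *: u) = c * L2inner w u.
Proof.
rewrite /L2inner -RintegralZl//; last exact: L2_mul_integrable.
by apply: eq_Rintegral => x _; rewrite mulrCA.
Qed.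

Lemma sqr_L2norm u : L2norm u ^+ 2 = L2inner u u.
Proof.
rewrite /L2norm /L2inner /Rintegral.
rewrite -powR_mulrn; last by apply: fine_ge0; exact: Lnorm_ge0.
have := fine_poweR 'N[mu]_2%:E[EFin \o u]%E 2.
rewrite poweR_Lnorm ?pnatr_eq0// => <-.
congr fine; apply: eq_integral => x _ /=.
by rewrite powR_mulrn// real_normK ?num_real.
Qed.

Lemma sqr_L2normZ (c : R) u : L2norm (c *: u) ^+ 2 = c ^+ 2 * L2norm u ^+ 2.
Proof. by rewrite !sqr_L2norm L2innerZr L2innerC L2innerZr mulrA. Qed.

Lemma sqr_L2normD u v :
  L2norm (u + v) ^+ 2 = L2norm u ^+ 2 + 2 * L2inner u v + L2norm v ^+ 2.
Proof.
rewrite !sqr_L2norm L2innerDr 2!(L2innerC (u + v)) !L2innerDr (L2innerC v u).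
ring.
Qed.

Lemma L2_integrable_norm (u : L2 mu) : mu setT \is a fin_num ->
  mu.-integrable setT (EFin \o (fun x => `|u x|)).
Proof.
move=> muT; apply/Lfun1_integrable/Lfun_norm/Lfun_subset12 => //.
exact: LfunP.
Qed.

Lemma Lnorm1_Rintegral (u : L2 mu) : mu setT \is a fin_num ->
  'N[mu]_1[EFin \o u]%E = (\int[mu]_x `|u x|)%:E.
Proof.
move=> muT; rewrite Lnorm1 /Rintegral fineK//.
exact: integrable_fin_num (L2_integrable_norm u muT).
Qed.

(** Hölder's inequality between $L^\infty$ and $L^1$, for the improved estimate. *)
Lemma L2inner_le (u v : L2 mu) (c : R) : mu setT \is a fin_num ->
  (\forall x \ae mu, `|u x| <= c) -> L2inner u v <= c * \int[mu]_x `|v x|.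
Proof.
move=> muT uc; have vi := L2_integrable_norm v muT.
rewrite -RintegralZl//; apply: ae_le_Rintegral.
- exact: L2_mul_integrable.
- exact: (integrableZl measurableT c vi).
apply: filterS uc => x uxc.
by rewrite (le_trans (ler_norm _))// normrM ler_wpM2r.
Qed.

End L2_inner_product.

(** * Inner product and adjoints in the Hilbert space *)

Section dot_product.
Context (R : realType) (H : normedModType R) (dot : {dot H for idfun}).
Hypothesis dotE : forall h : H, dot h h = `|h| ^+ 2.

Lemma dotC (g h : H) : dot g h = dot h g.
Proof. by rewrite hermC expr0 mul1r. Qed.

Lemma dotDr (f g h : H) : dot f (g + h) = dot f g + dot f h.
Proof. exact: linearDr. Qed.

Lemma dotBr (f g h : H) : dot f (g - h) = dot f g - dot f h.
Proof. exact: linearBr. Qed.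

Lemma dotBl (f g h : H) : dot (f - g) h = dot f h - dot g h.
Proof. by rewrite dotC dotBr !(dotC h). Qed.

Lemma dotZr (c : R) (f g : H) : dot f (c *: g) = c * dot f g.
Proof. exact: linearZr_LR. Qed.

Lemma dotNr (g h : H) : dot g (- h) = - dot g h.
Proof. exact: linearNr. Qed.

Lemma sqr_normD_dot (g h : H) :
  `|g + h| ^+ 2 = `|g| ^+ 2 + 2 * dot g h + `|h| ^+ 2.
Proof.
rewrite -!dotE dotDr 2!(dotC (g + h)) !dotDr (dotC h g); ring.
Qed.

Lemma dot_continuous (h : H) : continuous (dot h : H -> R^o).
Proof.
(* polarization *)
have -> : (dot h : H -> R^o) =
    (fun x : H => 4^-1 * (`|h + x| ^+ 2 - `|h - x| ^+ 2) : R^o).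
  by apply/funext => x; rewrite !sqr_normD_dot normrN dotNr; field.
move=> x; apply: cvgMl_tmp; apply: cvgB.
  rewrite expr2; apply: cvgM; apply: cvg_norm; apply: cvgD => //;
  exact: cvg_cst.
rewrite expr2; apply: cvgM; apply: cvg_norm; apply: cvgB => //; exact: cvg_cst.
Qed.

Section hilbert_adjoint.
Context (W : normedModType R) (S : {linear W -> H}) (h : H).

Let adj : W -> R^o := hilbert_adjoint dot S h.

Let adj_linear : linear adj.
Proof.
by move=> c u v; rewrite /adj /hilbert_adjoint linearP dotDr dotZr.
Qed.

HB.instance Definition _ := GRing.isLinear.Build R W R^o *:%R adj adj_linear.

(** [is_L2_adjoint] speaks only of continuous linear functionals, hence the linear structure on
    [adj] and the continuity check. With $T=SB$ the formula expresses $T^*=B^*S^*$. *)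
Lemma L2_adjoint_hilbert_adjoint d (X : measurableType d)
    (mu : {measure set X -> \bar R}) (B : L2 mu -> W)
    (Bstar : (W -> R) -> L2 mu) : continuous S -> is_L2_adjoint B Bstar ->
  forall u, L2inner (Bstar (hilbert_adjoint dot S h)) u = dot h (S (B u)).
Proof.
move=> Sc Badj u.
have adjc : continuous adj.
  by move=> w; apply: continuous_comp; [exact: Sc|exact: dot_continuous].
exact: (Badj [the {linear W -> R^o} of adj] adjc u).
Qed.

End hilbert_adjoint.
End dot_product.

(** * First-order optimality and the projection formula *)

Lemma first_order_ge0 (R : realFieldType) (l q : R) :
  (forall t, 0 < t <= 1 -> 0 <= t * l + t ^+ 2 * q) -> 0 <= l.
Proof.
move=> lq; rewrite leNgt; apply/negP => l0.
(* For $l<0$ the step $t=-l/s$ lies in $]0,1]$ and satisfies $t(1+|q|-l)=-l$, so $l+t|q|=-t(1-l)<0$,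
   which contradicts the hypothesis at this $t$. *)
pose s := 1 + `|q| - l.
have s0 : 0 < s by rewrite /s; have := normr_ge0 q; lra.
have ts : - l / s * s = - l by rewrite divfK// gt_eqF.
have t0 : 0 < - l / s by rewrite divr_gt0// oppr_gt0.
have t1 : - l / s <= 1 by rewrite ler_pdivrMr// /s; have := normr_ge0 q; lra.
have := lq (- l / s); rewrite t0 t1 => /(_ isT).
rewrite expr2 -mulrA -mulrDr pmulr_rge0//.
move: (- l / s) ts t0 {t1} => t ts t0.
have : t * q <= t * `|q| by rewrite ler_pM2l// ler_norm.
by rewrite /s in ts; nra.
Qed.

Section optimality.
Context d (X : measurableType d) (R : realType).
Variable mu : {measure set X -> \bar R}.
Hypothesis muT : mu setT \is a fin_num.
Context (H : normedModType R) (dot : {dot H for idfun}).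
Hypothesis dotE : forall h : H, dot h h = `|h| ^+ 2.
Variables (T : {linear L2 mu -> H}) (z : H) (a b : X -> R).

Lemma admissible_convex (u v : L2 mu) (t : R) : 0 < t <= 1 ->
  admissible a b u -> admissible a b v -> admissible a b (u + t *: (v - u)).
Proof.
move=> /andP[t0 t1] uab vab; rewrite /admissible.
apply: filterS2 uab vab => x /andP[au ub] /andP[av vb].
have -> : (u + t *: (v - u)) x = u x + t * (v x - u x) by [].
by apply/andP; split; nra.
Qed.

(** Along $u+t(v-u)$ the objective is a quadratic polynomial in $t$, whose linear coefficient cannot
    be negative at a minimiser. *)
Lemma variational_inequality (alpha : R) (u v : L2 mu) :
  solves T z a b alpha u -> admissible a b v ->
  0 <= dot (T u - z) (T (v - u)) + alpha * L2inner u (v - u).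
Proof.
move=> [uab umin] vab.
apply: (@first_order_ge0 _ _
  (2^-1 * `|T (v - u)| ^+ 2 + alpha / 2 * L2norm (v - u) ^+ 2)) => t t01.
have := umin _ (admissible_convex t01 uab vab).
rewrite /objective linearD linearZ/= (addrAC (T u)).
rewrite (sqr_normD_dot dotE (T u - z)) dotZr normrZ
  exprMn real_normK ?num_real//.
rewrite sqr_L2normD L2innerZr sqr_L2normZ.
lra.
Qed.

(** When the two variational inequalities are added, the data terms combine to $-\|T(u-u_0)\|^2$. *)
Lemma objective0_gap (alpha : R) (u u0 : L2 mu) :
  solves T z a b alpha u -> solves T z a b 0 u0 ->
  `|T u - T u0| ^+ 2 <= alpha * L2inner u (u0 - u).
Proof.
move=> us u0s.
have /= := variational_inequality us u0s.1.
have /= := variational_inequality u0s us.1.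
rewrite mul0r addr0 !linearB/= -dotE !dotBl !dotBr (dotC dot (T u0) (T u)).
lra.
Qed.

Section projection_formula.
Hypotheses (aoo : a \in Lfun mu +oo%E) (boo : b \in Lfun mu +oo%E).
Hypothesis ab : \forall x \ae mu, a x <= b x.
Variables (alpha : R) (u q : L2 mu).
Hypothesis alpha0 : 0 < alpha.
Hypothesis us : solves T z a b alpha u.
Hypothesis qE : forall v, L2inner q v = dot (T u - z) (T v).

Let clip : X -> R := fun x => Num.max (a x) (Num.min (b x) (- q x / alpha)).

Let clip_ab : \forall x \ae mu, a x <= clip x <= b x.
Proof.
apply: filterS ab => x abx.
by rewrite /clip le_max lexx/= ge_max abx ge_min lexx.
Qed.

Let clip_Lfun2 : clip \in Lfun mu 2%:E.
Proof.
have [Ma aM] := Lfun_oo_bounded aoo.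
have [Mb bM] := Lfun_oo_bounded boo.
apply: (@bounded_Lfun2 _ _ _ mu clip (Ma + Mb)) => //.
  apply: measurable_maxr.
    exact: Lfun_measurable aoo.
  apply: measurable_minr.
    exact: Lfun_measurable boo.
  by apply: measurable_funM => //; exact: measurableT_comp.
near=> x.
have /andP[ac cb] : a x <= clip x <= b x by near: x.
have aMx : `|a x| <= Ma by near: x.
have bMx : `|b x| <= Mb by near: x.
move: aMx bMx; rewrite !ler_norml => /andP[? ?] /andP[? ?].
by apply/andP; split; lra.
Unshelve. all: by end_near. Qed.

Let c : L2 mu := Lfun_Sub (lee1n 2) clip_Lfun2.

(** Here [q] represents $T^*(Tu-z)$. The clipped function [c] is admissible, and testing the
    variational inequality with it forces $\|c-u\|=0$. *)
Lemma solves_projection :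
  \forall x \ae mu, u x = Num.max (a x) (Num.min (b x) (- q x / alpha)).
Proof.
have : 0 <= L2inner q (c - u) + alpha * L2inner u (c - u).
  by rewrite qE; exact: variational_inequality.
(* With $w=-q/\alpha$ this reduces pointwise to $(c-u)(c-w)\le0$, which characterises $c$ as the
   projection of $w$ onto $[a,b]$; the cases are $w\ge b$, $a<w<b$ and $w\le a$. *)
have le_sqr : L2inner q (c - u) + alpha * L2inner u (c - u) <=
    - alpha * L2inner (c - u) (c - u).
  rewrite (L2innerC q) (L2innerC u) -!L2innerZr -L2innerDr.
  apply: ae_le_Rintegral; [exact: L2_mul_integrable..|].
  apply: filterS2 ab us.1 => x abx /andP[aux uxb].
  have -> : (c - u) x * (q + alpha *: u) x =
    (clip x - u x) * (q x + alpha * u x) by [].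
  have -> : (c - u) x * (- alpha *: (c - u)) x =
    (clip x - u x) * (- alpha * (clip x - u x)) by [].
  have qx : q x = - (- q x / alpha) * alpha.
    by rewrite mulNr divfK ?opprK ?gt_eqF.
  rewrite {1}qx /clip; move: (- q x / alpha) => w.
  rewrite -subr_ge0.
  case: (leP (b x) w) => bw; first rewrite max_r//.
    suff : 0 <= alpha * ((w - b x) * (b x - u x)) by nra.
    by apply: mulr_ge0; [exact: ltW|apply: mulr_ge0; rewrite subr_ge0].
  case: (leP (a x) w) => aw; first nra.
  suff : 0 <= alpha * ((a x - w) * (u x - a x)) by nra.
  by apply: mulr_ge0; [exact: ltW|apply: mulr_ge0; rewrite subr_ge0// ltW].
move=> /le_trans /(_ le_sqr); rewrite mulNr oppr_ge0 pmulr_rle0// => cu0.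
have cu : L2norm (c - u) = 0.
  apply/eqP; rewrite -sqrf_eq0 sqr_L2norm eq_le cu0; exact: L2inner_ge0.
have := fine_Lnormr_eq0 cu.
apply: filterS => x /(_ I) cux0.
have /eqP : clip x - u x = 0 by exact: cux0.
by rewrite subr_eq0 => /eqP.
Qed.

End projection_formula.
End optimality.

(** * The combined error estimate *)

Section regularization_error.
Context d (X : measurableType d) (R : realType).
Variable mu : {measure set X -> \bar R}.
Hypothesis muT : mu setT \is a fin_num.
Context (H : normedModType R) (dot : {dot H for idfun}).
Hypothesis dotE : forall h : H, dot h h = `|h| ^+ 2.
Variables (T : {linear L2 mu -> H}) (z : H) (a b : X -> R).
Hypotheses (aoo : a \in Lfun mu +oo%E) (boo : b \in Lfun mu +oo%E).

(** [K] is fixed before [alpha] and the solutions, so the final constants do not depend on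
    $\alpha$. *)
Lemma regularization_error (sigma : R) : 0 < sigma ->
  (\forall x \ae mu, a x <= - sigma /\ sigma <= b x) -> exists2 K : R, 0 < K &
  forall (alpha : R) (u q u0 : L2 mu), 0 < alpha ->
    solves T z a b alpha u -> solves T z a b 0 u0 ->
    (forall v, L2inner q v = dot (T u - z) (T v)) ->
  `|T u - T u0| ^+ 2 + alpha * (sigma * \int[mu]_x `|(u - u0) x|) <=
    alpha * (K * fine (mu (inactive_set a b alpha q))).
Proof.
move=> sigma_gt0 sigma_cond; have [Ma aM] := Lfun_oo_bounded aoo.
have [Mb bM] := Lfun_oo_bounded boo.
have ab : \forall x \ae mu, a x <= b x.
  by apply: filterS sigma_cond => x [? ?]; lra.
pose M := `|Ma| + `|Mb|.
have M0 : 0 <= M by rewrite addr_ge0.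
(* On $I_\alpha$ one has $|u|\le M$ and $|u-u_0|\le2M$, which gives the first two summands; the
   third makes [K] positive. *)
exists (2 * M ^+ 2 + sigma * (2 * M) + 1).
  have : 0 <= M ^+ 2 by exact: sqr_ge0.
  nra.
move=> alpha u q u0 alpha0 us u0s qE.
have u_proj := solves_projection muT dotE aoo boo ab alpha0 us qE.
have mI : measurable (inactive_set a b alpha q).
  apply: measurable_inactive_set => //.
    exact: Lfun_measurable aoo.
  exact: Lfun_measurable boo.
set I := inactive_set a b alpha q in mI *.
rewrite -Rintegral_indic//.
(* The bound $\|Tu-Tu_0\|^2\le\alpha(u,u_0-u)$ lets $\alpha$ be factored out, which leaves an
   inequality between integrands. *)
apply: (@le_trans _ _ (alpha * (L2inner u (u0 - u) +
    sigma * \int[mu]_x `|(u - u0) x|))).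
  by rewrite mulrDr lerD2r; have := objective0_gap dotE us u0s.
rewrite ler_pM2l//; apply: ae_le_Rintegral_comb.
- exact: L2_mul_integrable.
- exact: L2_integrable_norm.
- exact: fin_num_integrable_indic.
near=> x.
have -> : (u0 - u) x = u0 x - u x by [].
have -> : (u - u0) x = u x - u0 x by [].
have [aM' bM'] : `|a x| <= M /\ `|b x| <= M.
  have aMx : `|a x| <= Ma by near: x.
  have bMx : `|b x| <= Mb by near: x.
  have := ler_norm Ma; have := ler_norm Mb.
  have := normr_ge0 Ma; have := normr_ge0 Mb.
  by rewrite /M; split; lra.
have [asig bsig] : a x <= - sigma /\ sigma <= b x by near: x.
have /andP[au ub] : a x <= u x <= b x by near: x; exact: us.1.
have /andP[au0 u0b] : a x <= u0 x <= b x by near: x; exact: u0s.1.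
have ux : u x = Num.max (a x) (Num.min (b x) (- q x / alpha)) by near: x.
move: aM' bM'; rewrite !ler_norml => /andP[Ma1 Ma2] /andP[Mb1 Mb2].
rewrite indicE; case: (boolP (x \in I)) => [xI|].
  rewrite mulr1; have : `|u x - u0 x| <= 2 * M by rewrite ler_norml; lra.
  have : u x * (u0 x - u x) <= 2 * M ^+ 2.
    rewrite (le_trans (ler_norm _))// normrM expr2 mulrCA.
    by rewrite ler_pM// ler_norml; lra.
  nra.
move=> xI; rewrite mulr0.
(* Off $I_\alpha$ one of the strict inequalities fails. At the upper bound $u=b$ the left side is
   $(b-u_0)(\sigma-b)\le0$. *)
have [qb|qb] := leP (alpha * b x) (- q x).
  have uxb : u x = b x.
    by rewrite ux min_l ?max_r// ?ler_pdivlMr 1?mulrC//; lra.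
  by rewrite uxb ger0_norm ?subr_ge0//; nra.
have qa : - q x <= alpha * a x.
  rewrite leNgt; apply/negP => qa; move/negP: xI; apply.
  by rewrite inE /I /inactive_set /= qa qb.
(* At the lower bound the left side is $(u_0-a)(a+\sigma)\le0$. *)
have uxa : u x = a x.
  by rewrite ux max_l// ge_min ler_pdivrMr// [a x * _]mulrC qa orbT.
by rewrite uxa ler0_norm ?subr_le0//; nra.
Unshelve. all: by end_near. Qed.

End regularization_error.

(** * Finite measure of bounded sets *)

Section lebesgue_bounded.
Context (R : realType) (n : nat).

Lemma lebesgue_bounded_lty (A : set 'rV[R]_n.+1) :
  bounded_set A -> (@lebesgue_om R n A < +oo)%E.
Proof.
move=> /pinfty_ex_gt0[M M0 AM].
(* One cube covers [A]; the remaining boxes are points, of volume zero because the dimension is at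
   least one. *)
pose I k : 'rV[R]_n.+1 * 'rV[R]_n.+1 :=
  if k is 0 then (const_mx (- M), const_mx M) else (0, 0).
have vol0 k : (0 < k)%N -> box_volume (I k) = 0.
  by case: k => // k _; rewrite /box_volume big_ord_recl/= subrr mul0r.
apply: (@le_lt_trans _ _ (\sum_(k <oo) (box_volume (I k))%:E)%E).
  apply: ereal_inf_lbound; exists I => //; split=> [[|k] i|x Ax] /=.
  - by rewrite !mxE; lra.
  - exact: lexx.
  exists 0%N => // i /=; rewrite !mxE -ler_norml.
  apply: le_trans (AM _ Ax).
  rewrite /Num.norm/= mx_normrE.
  exact: (le_bigmax _ (fun ij : 'I_1 * 'I_n.+1 => `|x ij.1 ij.2|) (0, i)).
rewrite nneseries_recl//; last first.
  move=> k _; rewrite lee_fin; apply: prodr_ge0 => i _.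
  case: k => [|k]/=; rewrite ?mxE ?subrr//; lra.
rewrite eseries0 ?adde0 ?ltry// => k k1 _.
by rewrite vol0.
Qed.

End lebesgue_bounded.

(** * From the measure condition to powers of $\alpha$ *)

Lemma power_estimate_le (R : realType) (abar : R) (kappa : \bar R)
    (m f : R -> \bar R) (C : R) : 0 < C -> (0 < kappa)%E ->
  measure_condition abar kappa m ->
  (forall alpha, 0 < alpha < abar -> (f alpha <= C%:E * m alpha)%E) ->
  power_estimate abar kappa f.
Proof.
move=> C0; case: kappa => [r||//] _ /= mc fm.
  (* [D] may have any sign, while the estimate asks for a positive constant. *)
  have [D Dm] := mc; exists (C * (`|D| + 1)).
    by rewrite mulr_gt0// ltr_wpDl.
  move=> alpha alphab; apply: (le_trans (fm _ alphab)).
  rewrite -mulrA EFinM lee_pmul2l// (le_trans (Dm _ alphab))// lee_fin.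
  by rewrite ler_wpM2r ?powR_ge0// (le_trans (ler_norm D))// lerDl.
(* For infinite $\kappa$ the measures vanish, so $f\le0$ and the constant 1 serves every
   exponent. *)
move=> r; exists 1 => // alpha alphab; apply: (le_trans (fm _ alphab)).
by rewrite mc// mule0 lee_fin mul1r powR_ge0.
Qed.

(** Squares are compared, using $(\alpha^{(r+1)/2})^2=\alpha\,\alpha^r$. For infinite $\kappa$ the
    halved exponent is still infinite and [f] vanishes. *)
Lemma power_estimate_sqrt (R : realType) (abar : R) (kappa : \bar R)
    (m : R -> \bar R) (f : R -> R) (C : R) : 0 < C -> (0 < kappa)%E ->
  measure_condition abar kappa m ->
  (forall alpha, 0 < alpha < abar -> m alpha \is a fin_num) ->
  (forall alpha, 0 < alpha < abar -> 0 <= f alpha) ->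
  (forall alpha, 0 < alpha < abar ->
    f alpha ^+ 2 <= C * (alpha * fine (m alpha))) ->
  power_estimate abar ((kappa + 1) * (2^-1)%:E)%E (EFin \o f).
Proof.
move=> C0; case: kappa => [r||//] _ /= mc mfin f0 fm; last first.
  rewrite gt0_mulye ?lte_fin ?invr_gt0// => r; exists 1 => // alpha alphab.
  have := fm _ alphab; rewrite (mc _ alphab)/= !mulr0.
  rewrite real_exprn_even_le0 ?num_real// => /eqP ->.
  by rewrite lee_fin mul1r powR_ge0.
have [D Dm] := mc.
(* With $s=C|D|$, the constant $s+1$ satisfies $s\le(s+1)^2$, so no square root of $s$ is taken. *)
have D10 : 0 < C * `|D| + 1 by rewrite ltr_wpDl// mulr_ge0// ltW.
exists (C * `|D| + 1) => // alpha /[dup] alphab /andP[alpha0 _].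
rewrite lee_fin -ler_sqr ?nnegrE ?f0// ?mulr_ge0 ?powR_ge0 ?(ltW D10)//.
apply: (le_trans (fm _ alphab)).
have fmD : fine (m alpha) <= `|D| * alpha `^ r.
  rewrite -lee_fin fineK ?mfin// (le_trans (Dm _ alphab))// lee_fin.
  by rewrite ler_wpM2r ?powR_ge0// ler_norm.
have powE : (alpha `^ ((r + 1) / 2)) ^+ 2 = alpha * alpha `^ r.
  rewrite -powR_mulrn ?powR_ge0// -powRrM divfK//.
  by rewrite powRD ?(gt_eqF alpha0) ?implybT// powRr1 1?mulrC// ltW.
rewrite exprMn powE.
have P0 : 0 <= alpha * alpha `^ r by rewrite mulr_ge0 ?powR_ge0 ?ltW.
apply: (@le_trans _ _ (C * `|D| * (alpha * alpha `^ r))).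
  by rewrite -mulrA ler_pM2l// mulrCA ler_pM2l.
rewrite ler_wpM2r//; have : 0 <= C * `|D| by rewrite mulr_ge0// ltW.
by move: (C * `|D|) => s s0; nra.
Qed.

(** * The three estimates on a bounded domain *)

Theorem theorem15 (R : realType) (n : nat)
    (Omega : set (lebesgue_space R n)) (mOmega : measurable Omega)
    (bndOmega : bounded_set (Omega : set 'rV[R]_n.+1))
    (H : completeNormedModType R) (dot : {dot H for idfun})
    (dotE : forall h : H, dot h h = `|h| ^+ 2)
    (W : normedModType R)
    (B : {linear L2 (lebesgue_on mOmega) -> W}) (S : {linear W -> H})
    (T : {linear L2 (lebesgue_on mOmega) -> H})
    (B_cont : L2_continuous B) (S_cont : continuous S)
    (T_cont : L2_continuous T) (T_SB : forall u, T u = S (B u))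
    (Bstar : (W -> R) -> L2 (lebesgue_on mOmega))
    (Bstar_adj : is_L2_adjoint B Bstar)
    (z : H) (a b : lebesgue_space R n -> R)
    (aLoo : a \in Lfun (lebesgue_on mOmega) +oo%E)
    (bLoo : b \in Lfun (lebesgue_on mOmega) +oo%E)
    (ab : \forall x \ae lebesgue_on mOmega, a x <= b x)
    (ubar : R -> L2 (lebesgue_on mOmega))
    (ubar_sol : forall alpha : R, 0 < alpha -> solves T z a b alpha (ubar alpha))
    (kappa : \bar R) (kappa_gt0 : (0 < kappa)%E)
    (abar : R) (abar_gt0 : 0 < abar)
    (meas_cond : measure_condition abar kappa (fun alpha =>
       lebesgue_on mOmega (inactive_set a b alpha
         (Bstar (hilbert_adjoint dot S (T (ubar alpha) - z))))))
    (sigma : R) (sigma_gt0 : 0 < sigma)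
    (sigma_cond : \forall x \ae lebesgue_on mOmega,
       a x <= - sigma /\ sigma <= b x)
    (u0 : L2 (lebesgue_on mOmega)) (u0_sol : solves T z a b 0 u0) :
  [/\ power_estimate abar kappa (fun alpha =>
        'N[lebesgue_on mOmega]_1[EFin \o (ubar alpha - u0)%R]%E),
      power_estimate abar ((kappa + 1) * (2^-1)%:E)%E (fun alpha =>
        (`|T (ubar alpha) - T u0|)%:E)
    & (1 < kappa)%E ->
      (exists2 c : R, 0 < c & forall v, range T v ->
         ('N[lebesgue_on mOmega]_+oo[EFin \o Bstar (hilbert_adjoint dot S v)]
            <= (c * `|v|)%:E)%E) ->
      power_estimate abar kappa (fun alpha =>
        (`|T (ubar alpha) - T u0|)%:E)].
Proof.
set mu := lebesgue_on mOmega.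
have muT : mu setT \is a fin_num.
  rewrite ge0_fin_numE// /mu /lebesgue_on/= /mrestr setTI.
  exact: lebesgue_bounded_lty.
pose q alpha := Bstar (hilbert_adjoint dot S (T (ubar alpha) - z)).
have adjE h u : L2inner (Bstar (hilbert_adjoint dot S h)) u = dot h (T u).
  by rewrite T_SB; exact: L2_adjoint_hilbert_adjoint.
pose m alpha := mu (inactive_set a b alpha (q alpha)).
(* Finiteness lets the measure be handled as a real number. *)
have mfin alpha : m alpha \is a fin_num.
  rewrite ge0_fin_numE//; apply: (@le_lt_trans _ _ (mu setT)).
    apply: le_measure; rewrite ?inE//; apply: measurable_inactive_set => //.
      exact: Lfun_measurable aLoo.
    exact: Lfun_measurable bLoo.
  by rewrite -ge0_fin_numE.
have [K K0 err] :=
  regularization_error muT dotE T z aLoo bLoo sigma_gt0 sigma_cond.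
pose du alpha := \int[mu]_x `|(ubar alpha - u0) x|.
have errm alpha : 0 < alpha -> `|T (ubar alpha) - T u0| ^+ 2 +
    alpha * (sigma * du alpha) <= alpha * (K * fine (m alpha)).
  move=> alpha0.
  exact: (err _ _ (q alpha) _ alpha0 (ubar_sol _ alpha0) u0_sol (adjE _)).
have du0 alpha : 0 <= du alpha by exact: Rintegral_ge0.
(* Drop the squared state error and divide by $\alpha\sigma$. *)
have du_le alpha : 0 < alpha < abar ->
    ('N[mu]_1[EFin \o (ubar alpha - u0)%R] <= (K / sigma)%:E * m alpha)%E.
  move=> /andP[alpha0 _]; rewrite Lnorm1_Rintegral// -[m alpha]fineK//.
  rewrite -EFinM lee_fin mulrAC ler_pdivlMr// [leLHS]mulrC -(ler_pM2l alpha0).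
  by apply: le_trans (errm _ alpha0); rewrite lerDr sqr_ge0.
split.
- exact: (power_estimate_le (divr_gt0 K0 sigma_gt0) kappa_gt0 meas_cond du_le).
- apply: (@power_estimate_sqrt _ _ _ _ (fun alpha => `|T (ubar alpha) - T u0|)
    K K0 kappa_gt0 meas_cond) => // alpha /andP[alpha0 _]; first exact: mfin.
  (* Here the $L^1$ term is dropped instead. *)
  rewrite mulrCA; apply: le_trans (errm _ alpha0).
  rewrite lerDl; apply: mulr_ge0; first exact: ltW.
  by apply: mulr_ge0; [exact: ltW|exact: du0].
move=> _ [c c0 Tstar].
(* The state error is at most [c] times the $L^1$ control error, whose constant is $K/\sigma$. *)
apply: (@power_estimate_le _ _ _ m _ (c * (K / sigma))) => //.
  by rewrite !mulr_gt0 ?invr_gt0.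
move=> alpha alphab; rewrite EFinM -muleA.
apply: (@le_trans _ _ (c%:E * 'N[mu]_1[EFin \o (ubar alpha - u0)%R])%E).
  rewrite Lnorm1_Rintegral// -EFinM lee_fin -linearB.
  set v := ubar alpha - u0.
  (* If $Tv\ne0$, one factor $\|Tv\|$ cancels from $\|Tv\|^2=(T^*Tv,v)\le c\|Tv\|\,\|v\|_{L^1}$. *)
  have [->|Tv0] := eqVneq (T v) 0.
    by rewrite normr0 mulr_ge0 ?(ltW c0)// du0.
  rewrite -(ler_pM2l (_ : 0 < `|T v|)) ?normr_gt0// -expr2 -dotE -adjE.
  rewrite mulrA [`|_| * c]mulrC; apply: L2inner_le => //.
  by apply: Lnorm_oo_le_ae; apply: Tstar; exists v.
by rewrite lee_pmul2l// du_le.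
Qed.
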